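(* Let $(\{(l_1,w_1),\ldots,(l_{|N|},w_{|N|})\}, l_{\mathrm{bin}})$ be nonnegative integers with $0<l_k\le l_{\mathrm{bin}}$, and let $(N,v)$ be the greedy knapsack budgeted game with $v(S)=w(\mathcal A'(S))$ for all $S\subseteq N$, where $\mathcal A'$ is the greedy heuristic described in the context. Then the Shapley value $\phi_i(v)$ of any given agent $i$ can be computed in time $O\big(l_{\mathrm{bin}}^5\, w_{\max}^5\, |N|^8\big)$, where $w_{\max}=\lceil l_{\mathrm{bin}}\cdot \max_k w_k/l_k\rceil$.
   Context: A cooperative game $(N,v)$ consists of a finite set $N$ of agents and a function $v:2^N\to\mathbb R$ with $v(\emptyset)=0$. The Shapley value of agent $i$ is $\phi_i(v)=\sum_{S\subseteq N\setminus\{i\}}\frac{|S|!\,(|N|-|S|-1)!}{|N|!}\big(v(S\cup\{i\})-v(S)\big)$. Write $w(S)=\sum_{k\in S}w_k$, $l(S)=\sum_{k\in S}l_k$. Fix a linear order on $N$ (agents labeled $1,\ldots,|N|$) such that $w_1/l_1\ge w_2/l_2\ge\cdots\ge w_{|N|}/l_{|N|}$. The greedy heuristic $\mathcal A'(S)$ for $S\subseteq N$ nonempty: (1) let $a$ be the agent of $S$ with maximum $w_a$, ties broken by lowest index; (2) go through the agents of $S$ in increasing index order (i.e. decreasing $w_k/l_k$), adding each to a set $S'$ while the total length stays at most $l_{\mathrm{bin}}$, and stop at the first agent that does not fit; (3) return $S'$ if $w(S')\ge w_a$, and $\{a\}$ otherwise. Set $\mathcal A'(\emptyset)=\emptyset$.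 Running times count arithmetic operations at unit cost. *)

(* Defs.v *)
From Stdlib Require Import QArith Qround Qminmax List Arith ZArith.
Import ListNotations.
Open Scope Q_scope.

(* A unit-cost RAM model: registers hold exact rationals, every executed
   instruction (arithmetic operation, comparison/jump, (indirect) memory
   access, constant load) costs one unit.                              *)

Inductive binop := OAdd | OSub | OMul | ODiv.

Inductive instr :=
  | IConst (d : nat) (q : Q)
  | IOp (o : binop) (d a b : nat)
  | ILoad (d a : nat)
  | IStore (a s : nat)
  | IJle (a b t : nat).

Definition program := list instr.
Definition memory := nat -> Q.

Definition upd (m : memory) (d : nat) (x : Q) : memory :=
  fun a => if Nat.eqb a d then x else m a.

Definition addr (q : Q) : nat := Z.to_nat (Qfloor q).

Definition eval_op (o : binop) (x y : Q) : Q :=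
  match o with
  | OAdd => x + y | OSub => x - y | OMul => x * y | ODiv => x / y
  end.

Definition step (ins : instr) (pc : nat) (m : memory) : nat * memory :=
  match ins with
  | IConst d q => (S pc, upd m d q)
  | IOp o d a b => (S pc, upd m d (eval_op o (m a) (m b)))
  | ILoad d a => (S pc, upd m d (m (addr (m a))))
  | IStore a s => (S pc, upd m (addr (m a)) (m s))
  | IJle a b t => (if Qle_bool (m a) (m b) then t else S pc, m)
  end.

Fixpoint run (P : program) (fuel pc : nat) (m : memory) : option memory :=
  match nth_error P pc with
  | None => Some m
  | Some ins =>
      match fuel with
      | O => None
      | S f => let '(pc', m') := step ins pc m in run P f pc' m'
      end
  end.

Definition Qnat (n : nat) : Q := inject_Z (Z.of_nat n).

(* Input encoding: mem[0] = |N|, mem[1] = l_bin, mem[2] = agent index i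
   (0-based), mem[3+2k] = l_{k+1}, mem[4+2k] = w_{k+1}, all else 0.
   The output is read from mem[0] after halting. *)
Definition init_mem (items : list (nat * nat)) (lbin i : nat) : memory :=
  fun a =>
    match a with
    | O => Qnat (length items)
    | S O => Qnat lbin
    | S (S O) => Qnat i
    | S (S (S b)) =>
        match nth_error items (Nat.div2 b) with
        | None => 0
        | Some (l, w) => if Nat.even b then Qnat l else Qnat w
        end
    end.

(* The greedy knapsack budgeted game.  Agents are 0..n-1 (agent k+1 of
   the paper is index k); item k is (l_k, w_k).  A coalition is a bit list
   of length n.                                                        *)

Section Game.
Variable items : list (nat * nat).
Variable lbin : nat.

Definition len (k : nat) : nat := fst (nth k items (0%nat, 0%nat)).
Definition wt (k : nat) : nat := snd (nth k items (0%nat, 0%nat)).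

Definition wsum (S : list nat) : nat := fold_right (fun k acc => (wt k + acc)%nat) 0%nat S.

Definition members (S : list bool) : list nat :=
  filter (fun k => nth k S false) (seq 0 (length items)).

Definition argmax_w (a0 : nat) (ms : list nat) : nat :=
  fold_left (fun best k => if Nat.ltb (wt best) (wt k) then k else best) ms a0.

Fixpoint greedy_prefix (ms : list nat) (acc : nat) : list nat :=
  match ms with
  | [] => []
  | k :: t => if Nat.leb (acc + len k) lbin
              then k :: greedy_prefix t (acc + len k) else []
  end.

Definition greedyA (S : list bool) : list nat :=
  match members S with
  | [] => []
  | a0 :: t =>
      let a := argmax_w a0 t in
      let S' := greedy_prefix (a0 :: t) 0 in
      if Nat.leb (wt a) (wsum S') then S' else [a]
  end.

Definition v (S : list bool) : nat := wsum (greedyA S).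

Fixpoint bitlists (n : nat) : list (list bool) :=
  match n with
  | O => [[]]
  | S n => map (cons false) (bitlists n) ++ map (cons true) (bitlists n)
  end.

Fixpoint set_true (S : list bool) (i : nat) : list bool :=
  match S, i with
  | [], _ => []
  | _ :: t, O => true :: t
  | b :: t, S j => b :: set_true t j
  end.

Definition card (S : list bool) : nat := length (filter (fun b => b) S).

Definition shapley (i : nat) : Q :=
  let n := length items in
  fold_right Qplus 0
    (map (fun S =>
            Qnat (fact (card S) * fact (n - card S - 1)) / Qnat (fact n)
            * (Qnat (v (set_true S i)) - Qnat (v S)))
         (filter (fun S => negb (nth i S false)) (bitlists n))).

Definition ratio (k : nat) : Q := Qnat (wt k) / Qnat (len k).

Definition wmax : nat :=
  Z.to_nat (Qceiling (Qnat lbin *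
    fold_right Qmax 0 (map ratio (seq 0 (length items))))).

End Game.

(* Main.v *)
Require Import Defs.
From Stdlib Require Import QArith Qround Qminmax List Arith ZArith Lia Lqa.
Import ListNotations.
Open Scope Q_scope.

(* Read a coalition in index order and keep its length L and value V so far.
   While everything fits, V is the accumulated weight; once an agent does not
   fit, the greedy prefix is final and V becomes the maximum of itself and the
   weights of the agents still to come (earlier weights are dominated by the
   prefix).  So v is computed by an automaton with state (L, V), and the Shapley
   value is a backward dynamic program over (number of agents left, number of
   members, L, V): at agent i the step is "include minus exclude", at any other
   agent "exclude plus include", and the final states are weighted by
   s! (n-1-s)! / n!.  Since w_k <= l_k w_0 / l_0, all V reached are at most
   lbin * w_0 <= lbin * wmax, so about n^2 lbin^2 wmax cells suffice.

   The machine fills the cells one after the other in consecutive registers with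
   a single loop that advances the cell coordinates like an odometer; both
   values a cell needs lie at computable offsets in the previous layer. *)

(** * Natural numbers as rationals, and finite sums of rationals *)

Lemma Qnat_add (a b : nat) : Qnat a + Qnat b = Qnat (a + b).
Proof. unfold Qnat, Qplus, inject_Z; cbn [Qnum Qden]. f_equal; lia. Qed.

Lemma Qnat_mul (a b : nat) : Qnat a * Qnat b = Qnat (a * b).
Proof. unfold Qnat, Qmult, inject_Z; cbn [Qnum Qden]. f_equal; lia. Qed.

Lemma Qnat_sub (a b : nat) : (b <= a)%nat -> Qnat a - Qnat b = Qnat (a - b).
Proof.
  intros H. unfold Qnat, Qminus, Qplus, Qopp, inject_Z; cbn [Qnum Qden].
  f_equal; lia.
Qed.

Lemma Qnat_leb (a b : nat) : Qle_bool (Qnat a) (Qnat b) = Nat.leb a b.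
Proof.
  apply Bool.eq_iff_eq_true. rewrite Qle_bool_iff, Nat.leb_le.
  unfold Qnat. rewrite <- Zle_Qle. lia.
Qed.

Lemma Qnat_le (a b : nat) : Qnat a <= Qnat b <-> (a <= b)%nat.
Proof. unfold Qnat. rewrite <- Zle_Qle. lia. Qed.

Lemma Qnat_pos (a : nat) : (0 < a)%nat -> 0 < Qnat a.
Proof. intros H. change 0 with (inject_Z 0). unfold Qnat. rewrite <- Zlt_Qlt. lia. Qed.

Lemma addr_Qnat (a : nat) : addr (Qnat a) = a.
Proof. unfold addr, Qnat. rewrite Qfloor_Z. lia. Qed.

Definition Qsum (l : list Q) : Q := fold_right Qplus 0 l.

Lemma Qsum_app (l1 l2 : list Q) : Qsum (l1 ++ l2) == Qsum l1 + Qsum l2.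
Proof.
  induction l1 as [|x l1 IH]; [symmetry; apply Qplus_0_l|].
  change (x + Qsum (l1 ++ l2) == x + Qsum l1 + Qsum l2). rewrite IH. ring.
Qed.

Lemma Qsum_map_ext {A} (f g : A -> Q) (l : list A) :
  (forall x, In x l -> f x == g x) -> Qsum (map f l) == Qsum (map g l).
Proof.
  induction l as [|x l IH]; cbn; intros H; [reflexivity|].
  rewrite (H x) by auto. apply Qplus_comp; [reflexivity|]. apply IH; auto.
Qed.

Lemma Qsum_map_sub {A} (f g : A -> Q) (l : list A) :
  Qsum (map (fun x => f x - g x) l) == Qsum (map f l) - Qsum (map g l).
Proof.
  induction l as [|x l IH]; cbn; [ring|].
  change (f x - g x + Qsum (map (fun x => f x - g x) l) ==
          f x + Qsum (map f l) - (g x + Qsum (map g l))).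
  rewrite IH. ring.
Qed.

(** * The game as an automaton *)

Section Value.
Variables (items : list (nat * nat)) (lbin : nat).
Notation n := (length items).
Notation len := (len items).
Notation wt := (wt items).
Notation wsum := (wsum items).

(* A pair (L, V): total length and value of the coalition read so far.
   L = lbin + 1 encodes that the greedy pass has stopped. *)
Definition absorb (st : nat * nat) (k : nat) : nat * nat :=
  let '(L, V) := st in
  if Nat.leb (L + len k) lbin then (L + len k, V + wt k)%nat
  else (S lbin, Nat.max V (wt k)).

Definition max_wt (ms : list nat) : nat := fold_right (fun k acc => Nat.max (wt k) acc) 0%nat ms.

Lemma absorb_stopped (ms : list nat) (V : nat) :
  snd (fold_left absorb ms (S lbin, V)) = Nat.max V (max_wt ms).
Proof.
  revert V; induction ms as [|k ms IH]; intros V; cbn [fold_left max_wt fold_right absorb snd].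
  - lia.
  - destruct (Nat.leb_spec (S lbin + len k) lbin); [lia|].
    rewrite IH. fold (max_wt ms). lia.
Qed.

(* Before the pass stops every member read is in the greedy prefix, so its
   weight is already dominated by V. *)
Lemma absorb_greedy (ms : list nat) (L V : nat) :
  snd (fold_left absorb ms (L, V))
  = Nat.max (V + wsum (greedy_prefix items lbin ms L)) (max_wt ms).
Proof.
  revert L V; induction ms as [|k ms IH]; intros L V;
    cbn [fold_left max_wt fold_right absorb snd greedy_prefix Defs.wsum].
  - lia.
  - fold (max_wt ms). destruct (Nat.leb_spec (L + len k) lbin).
    + rewrite IH. cbn [Defs.wsum fold_right]. fold (wsum (greedy_prefix items lbin ms (L + len k))). lia.
    + rewrite absorb_stopped. cbn. lia.
Qed.

Lemma wt_argmax (ms : list nat) (a : nat) :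
  wt (argmax_w items a ms) = Nat.max (wt a) (max_wt ms).
Proof.
  revert a; induction ms as [|k ms IH]; intros a; cbn [argmax_w fold_left max_wt fold_right].
  - lia.
  - fold (max_wt ms). fold (argmax_w items (if Nat.ltb (wt a) (wt k) then k else a) ms).
    rewrite IH. destruct (Nat.ltb_spec (wt a) (wt k)); lia.
Qed.

(** Returning the prefix when it weighs at least [w_a] and the single agent [a] otherwise amounts to
    the larger of the two weights, which is what [absorb_greedy] gives from the state (0, 0). *)
Lemma v_fold_absorb (T : list bool) :
  v items lbin T = snd (fold_left absorb (members items T) (0, 0)%nat).
Proof.
  rewrite absorb_greedy. unfold v, greedyA.
  destruct (members items T) as [|a ms]; [reflexivity|].
  assert (Hm : wt (argmax_w items a ms) = max_wt (a :: ms)) by apply wt_argmax.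
  rewrite <- Hm. cbv zeta.
  destruct (Nat.leb_spec (wt (argmax_w items a ms))
    (wsum (greedy_prefix items lbin (a :: ms) 0))); [|cbn [Defs.wsum fold_right]]; lia.
Qed.

(* The bits of T are the memberships of agents k, k+1, ... *)
Fixpoint value_from (k : nat) (T : list bool) (st : nat * nat) : nat :=
  match T with
  | [] => snd st
  | b :: T => value_from (S k) T (if b then absorb st k else st)
  end.

Lemma value_from_fold (T : list bool) (k : nat) (st : nat * nat) :
  value_from k T st =
  snd (fold_left absorb (filter (fun j => nth (j - k) T false) (seq k (length T))) st).
Proof.
  revert k st; induction T as [|b T IH]; intros k st; cbn [value_from length seq filter]; [reflexivity|].
  assert (Hf : filter (fun j => nth (j - k) (b :: T) false) (seq (S k) (length T))
             = filter (fun j => nth (j - S k) T false) (seq (S k) (length T))).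
  { apply filter_ext_in. intros j Hj. apply in_seq in Hj.
    replace (j - k)%nat with (S (j - S k)) by lia. reflexivity. }
  rewrite Hf, Nat.sub_diag, IH. destruct b; reflexivity.
Qed.

Lemma bitlists_length (d : nat) (T : list bool) : In T (bitlists d) -> length T = d.
Proof.
  revert T; induction d as [|d IH]; cbn; intros T H.
  - destruct H as [<-|[]]; reflexivity.
  - apply in_app_or in H. destruct H as [H|H]; apply in_map_iff in H;
      destruct H as (T' & <- & H); cbn; f_equal; auto.
Qed.

Lemma set_true_length (T : list bool) (j : nat) : length (set_true T j) = length T.
Proof. revert j; induction T as [|b T IH]; intros [|j]; cbn; auto. Qed.

Lemma v_value_from (T : list bool) :
  length T = n -> v items lbin T = value_from 0 T (0, 0)%nat.
Proof.
  intros H. rewrite v_fold_absorb, value_from_fold, H. unfold members.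
  do 2 f_equal. apply filter_ext. intros j. now rewrite Nat.sub_0_r.
Qed.

(** * The Shapley value as a backward recursion *)

Variable i : nat.

Definition shapley_coef (s : nat) : Q := Qnat (fact s * fact (n - s - 1)) / Qnat (fact n).

(* Contribution to the Shapley value of all completions of a partial coalition
   with s members other than i and state (L, V), when d agents are left. *)
Fixpoint contribution (d s L V : nat) : Q :=
  match d with
  | O => shapley_coef s * Qnat V
  | S d' =>
      let k := (n - d)%nat in
      let '(L', V') := absorb (L, V) k in
      if Nat.eqb k i then contribution d' s L' V' - contribution d' s L V
      else contribution d' s L V + contribution d' (S s) L' V'
  end.

Lemma filter_map {A B} (f : A -> B) (p : B -> bool) (l : list A) :
  filter p (map f l) = map f (filter (fun x => p (f x)) l).
Proof. induction l as [|x l IH]; cbn; [reflexivity|]. destruct (p (f x)); cbn; now rewrite IH. Qed.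

(** Once agent [i] has been read, the recursion branches on the membership of agent n-d just as
    [bitlists] branches on the head bit. *)
Lemma contrib_after (d s : nat) (st : nat * nat) :
  (i + d < n)%nat ->
  contribution d s (fst st) (snd st) ==
  Qsum (map (fun T => shapley_coef (s + card T) * Qnat (value_from (n - d) T st)) (bitlists d)).
Proof.
  revert s st; induction d as [|d IH]; intros s st Hd.
  - cbn. rewrite Nat.add_0_r. ring.
  - cbn [contribution bitlists]. rewrite <- surjective_pairing.
    rewrite (surjective_pairing (absorb st (n - S d))).
    destruct (Nat.eqb_spec (n - S d) i) as [He|_]; [lia|].
    rewrite (IH s st), (IH (S s)) by lia.
    rewrite map_app, Qsum_app, !map_map.
    replace (n - d)%nat with (S (n - S d)) by lia.
    apply Qplus_comp; apply Qsum_map_ext; intros T _; cbn [value_from].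
    + reflexivity.
    + unfold card at 2; cbn [filter length]. fold (card T).
      replace (s + S (card T))%nat with (S s + card T)%nat by lia. reflexivity.
Qed.

(** Until [i] is read, the branching again follows [bitlists]. At [i] both branches keep the same s,
    since [i] is not counted, so the two sums share their coefficients and combine into marginal
    contributions. *)
Lemma contrib_before (d s : nat) (st : nat * nat) :
  (d <= n)%nat -> (i < n)%nat -> (n <= i + d)%nat ->
  contribution d s (fst st) (snd st) ==
  Qsum (map (fun T => shapley_coef (s + card T) *
               (Qnat (value_from (n - d) (set_true T (i - (n - d))) st)
                - Qnat (value_from (n - d) T st)))
          (filter (fun T => negb (nth (i - (n - d)) T false)) (bitlists d))).
Proof.
  revert s st; induction d as [|d IH]; intros s st Hdn Hi Hd; [lia|].
  cbn [contribution bitlists]. rewrite <- surjective_pairing.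
  rewrite (surjective_pairing (absorb st (n - S d))).
  rewrite filter_app, map_app, Qsum_app, !filter_map, !map_map.
  destruct (Nat.eqb_spec (n - S d) i) as [<-|Hne].
  - rewrite Nat.sub_diag. cbn [nth negb].
    rewrite (contrib_after d s st), (contrib_after d s (absorb st (n - S d))) by lia.
    (* With [i] as head bit, the filter keeps the whole [false] half of [bitlists] and drops the
       [true] half. *)
    assert (Ht : forall l : list (list bool), filter (fun _ => true) l = l)
      by (induction l as [|x l IHl]; cbn; congruence).
    assert (Hf : forall l : list (list bool), filter (fun _ => false) l = [])
      by (induction l as [|x l IHl]; cbn; congruence).
    rewrite Ht, Hf. cbn [map Qsum fold_right]. rewrite Qplus_0_r, <- Qsum_map_sub.
    apply Qsum_map_ext. intros T _. cbn [set_true value_from].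
    replace (n - d)%nat with (S (n - S d)) by lia.
    change (card (false :: T)) with (card T). ring.
  - rewrite (IH s st), (IH (S s)) by lia.
    replace (i - (n - S d))%nat with (S (i - (n - d))) by lia. cbn [nth].
    apply Qplus_comp; apply Qsum_map_ext; intros T _; cbn [set_true value_from];
      replace (S (n - S d)) with (n - d)%nat by lia.
    + reflexivity.
    + change (card (true :: T)) with (S (card T)).
      replace (s + S (card T))%nat with (S s + card T)%nat by lia. reflexivity.
Qed.

Lemma shapley_contrib : (i < n)%nat -> shapley items lbin i == contribution n 0 0 0.
Proof.
  intros Hi. rewrite (contrib_before n 0 (0, 0)%nat) by lia.
  rewrite !Nat.sub_diag, Nat.sub_0_r. unfold shapley. apply Qsum_map_ext.
  intros T HT. apply filter_In in HT. destruct HT as [HT _]. apply bitlists_length in HT.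
  rewrite !v_value_from by (rewrite ?set_true_length; exact HT). reflexivity.
Qed.

Lemma shapley_coef_0 : (0 < n)%nat -> shapley_coef 0 == 1 / Qnat n.
Proof.
  intros Hn. unfold shapley_coef. replace (n - 0 - 1)%nat with (pred n) by lia.
  cbn [fact]. rewrite Nat.mul_1_l.
  replace (fact n) with (n * fact (pred n))%nat
    by (destruct n; [lia|]; cbn [pred]; reflexivity).
  rewrite <- Qnat_mul. pose proof (Qnat_pos n Hn).
  pose proof (Qnat_pos _ (lt_O_fact (pred n))). field. split; lra.
Qed.

(** Allows the machine to update the coefficient in constant time when s advances, without ever
    computing a factorial. *)
Lemma shapley_coef_S (s : nat) :
  (S s < n)%nat ->
  shapley_coef (S s) == shapley_coef s * Qnat (S s) / Qnat (n - S s).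
Proof.
  intros Hs. unfold shapley_coef.
  replace (n - s - 1)%nat with (S (n - S s - 1)) by lia.
  cbn [fact]. fold (fact (S s)).
  change (fact s + s * fact s)%nat with (S s * fact s)%nat.
  change (fact (n - S s - 1) + (n - S s - 1) * fact (n - S s - 1))%nat
    with (S (n - S s - 1) * fact (n - S s - 1))%nat.
  replace (S (n - S s - 1)) with (n - S s)%nat by lia.
  rewrite <- !Qnat_mul. pose proof (Qnat_pos _ (lt_O_fact n)).
  assert (0 < Qnat (n - S s)) by (apply Qnat_pos; lia). field. split; lra.
Qed.

(** Adding a zero weight or taking the maximum with it keeps V at 0. This settles the degenerate
    inputs on which the loop is bypassed. *)
Lemma contrib_zero : (forall k, (k < n)%nat -> wt k = 0%nat) ->
  forall d s L, (d <= n)%nat -> contribution d s L 0 == 0.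
Proof.
  intros Hw. induction d as [|d IH]; intros s L Hd; cbn [contribution absorb].
  - apply Qmult_0_r.
  - rewrite (Hw (n - S d)%nat) by lia. cbn [Nat.max Nat.add].
    destruct (Nat.leb _ _), (Nat.eqb _ _); rewrite !IH by lia; ring.
Qed.

(** * Bounds on weights and densities *)

(** The weight is ratio times length; the ratio is at most the maximal one, the length at most
    [lbin], and the ceiling only increases the product. *)
Lemma wt_le_wmax (k : nat) :
  (k < n)%nat -> (0 < len k)%nat -> (len k <= lbin)%nat -> (wt k <= wmax items lbin)%nat.
Proof.
  intros Hk Hl Hb. unfold wmax.
  set (M := fold_right Qmax 0 (map (ratio items) (seq 0 n))).
  assert (HM : ratio items k <= M).
  { assert (Hin : In k (seq 0 n)) by (apply in_seq; lia).
    unfold M. induction (seq 0 n) as [|j js IHjs]; [destruct Hin|].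
    cbn [map fold_right]. destruct Hin as [->|Hin].
    - apply Q.le_max_l.
    - eapply Qle_trans; [now apply IHjs|apply Q.le_max_r]. }
  assert (Hr : Qnat (wt k) <= Qnat lbin * M).
  { assert (Hlk := Qnat_pos _ Hl).
    apply Qnat_le in Hb.
    assert (Hw : Qnat (wt k) == ratio items k * Qnat (len k))
      by (unfold ratio; field; lra).
    assert (H0 : 0 <= ratio items k).
    { unfold ratio. apply Qle_shift_div_l; [exact Hlk|]. rewrite Qmult_0_l.
      apply (Qnat_le 0); lia. }
    rewrite Hw. nra. }
  pose proof (Qle_trans _ _ _ Hr (Qle_ceiling _)) as Hc.
  unfold Qnat in Hc at 1. rewrite <- Zle_Qle in Hc. lia.
Qed.

Lemma ratio_cross (k k' : nat) :
  (0 < len k)%nat -> (0 < len k')%nat -> ratio items k' <= ratio items k ->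
  (wt k' * len k <= wt k * len k')%nat.
Proof.
  intros Hk Hk' H. apply Qnat_pos in Hk, Hk'. apply Qnat_le. rewrite <- !Qnat_mul.
  assert (Hw : Qnat (wt k) == ratio items k * Qnat (len k)) by (unfold ratio; field; lra).
  assert (Hw' : Qnat (wt k') == ratio items k' * Qnat (len k')) by (unfold ratio; field; lra).
  rewrite Hw, Hw'. assert (0 < Qnat (len k) * Qnat (len k')) by nra. nra.
Qed.

End Value.

(** * Structured code and its compilation *)

(** Loop-free code, so that [exec] is a total function; the single loop is added at the level of
    programs by [while_le]. *)
Inductive code :=
  | Skip
  | Do (ins : instr)
  | Seq (c1 c2 : code)
  | IfLe (a b : nat) (c1 c2 : code).

Declare Scope code_scope.
Infix ";;" := Seq (at level 61, right associativity) : code_scope.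

Definition seqs (l : list code) : code := fold_right Seq Skip l.

Fixpoint exec (c : code) (m : memory) : memory :=
  match c with
  | Skip => m
  | Do ins => snd (step ins 0 m)
  | Seq c1 c2 => exec c2 (exec c1 m)
  | IfLe a b c1 c2 => if Qle_bool (m a) (m b) then exec c1 m else exec c2 m
  end.

Lemma exec_Seq (c1 c2 : code) (m : memory) : exec (Seq c1 c2) m = exec c2 (exec c1 m).
Proof. reflexivity. Qed.

Fixpoint size (c : code) : nat :=
  match c with
  | Skip => 0
  | Do _ => 1
  | Seq c1 c2 => size c1 + size c2
  | IfLe _ _ c1 c2 => 2 + size c1 + size c2
  end.

(** The else branch comes first: a successful test jumps over it, and it ends with [IJle a a], an
    unconditional jump over the then branch. *)
Fixpoint compile (pc : nat) (c : code) : program :=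
  match c with
  | Skip => []
  | Do ins => [ins]
  | Seq c1 c2 => compile pc c1 ++ compile (pc + size c1) c2
  | IfLe a b c1 c2 =>
      IJle a b (pc + 2 + size c2)
      :: compile (pc + 1) c2
      ++ IJle a a (pc + 2 + size c2 + size c1)
      :: compile (pc + 2 + size c2) c1
  end.

Definition no_jump (ins : instr) : bool :=
  match ins with IJle _ _ _ => false | _ => true end.

Fixpoint structured (c : code) : bool :=
  match c with
  | Skip => true
  | Do ins => no_jump ins
  | Seq c1 c2 | IfLe _ _ c1 c2 => structured c1 && structured c2
  end.

Lemma length_compile (c : code) (pc : nat) : length (compile pc c) = size c.
Proof.
  revert pc; induction c as [|ins|c1 IH1 c2 IH2|a b c1 IH1 c2 IH2]; intros pc;
    cbn [compile size length]; rewrite ?length_app; cbn [length]; rewrite ?IH1, ?IH2; lia.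
Qed.

Definition code_at (P : program) (pc : nat) (F : program) : Prop :=
  forall j ins, nth_error F j = Some ins -> nth_error P (pc + j) = Some ins.

Lemma code_at_app (P : program) (pc : nat) (F1 F2 : program) :
  code_at P pc (F1 ++ F2) -> code_at P pc F1 /\ code_at P (pc + length F1) F2.
Proof.
  intros H; split; intros j ins Hj.
  - apply H. rewrite nth_error_app1; [exact Hj|]. apply nth_error_Some. congruence.
  - rewrite <- Nat.add_assoc. apply H. rewrite nth_error_app2 by lia.
    replace (length F1 + j - length F1)%nat with j by lia. exact Hj.
Qed.

Lemma code_at_cons (P : program) (pc : nat) (ins : instr) (F : program) :
  code_at P pc (ins :: F) -> nth_error P pc = Some ins /\ code_at P (pc + 1) F.
Proof.
  intros H; split.
  - rewrite <- (Nat.add_0_r pc). now apply H.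
  - intros j ins' Hj. rewrite <- Nat.add_assoc. now apply H.
Qed.

Lemma run_step (P : program) (f pc : nat) (m : memory) (ins : instr) :
  nth_error P pc = Some ins ->
  run P (1 + f) pc m = run P f (fst (step ins pc m)) (snd (step ins pc m)).
Proof. intros H. cbn [run Nat.add]. rewrite H. now destruct (step ins pc m). Qed.

Lemma run_halt (P : program) (f pc : nat) (m : memory) :
  nth_error P pc = None -> run P f pc m = Some m.
Proof. intros H. destruct f; cbn [run]; now rewrite H. Qed.

(** Quantifying over the leftover fuel [f] makes runs compose. [k] is only an upper bound because
    the two branches of a conditional may differ in length. *)
Definition reaches (P : program) (k pc : nat) (m : memory) (pc' : nat) (m' : memory) : Prop :=
  exists j, (j <= k)%nat /\ forall f, run P (j + f) pc m = run P f pc' m'.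

Lemma reaches_refl (P : program) (pc : nat) (m : memory) : reaches P 0 pc m pc m.
Proof. now exists 0%nat. Qed.

Lemma reaches_trans (P : program) (k1 k2 pc1 pc2 pc3 : nat) (m1 m2 m3 : memory) :
  reaches P k1 pc1 m1 pc2 m2 -> reaches P k2 pc2 m2 pc3 m3 ->
  reaches P (k1 + k2) pc1 m1 pc3 m3.
Proof.
  intros (j1 & H1 & R1) (j2 & H2 & R2). exists (j1 + j2)%nat. split; [lia|].
  intros f. now rewrite <- Nat.add_assoc, R1.
Qed.

Lemma reaches_weaken (P : program) (k k' pc pc' : nat) (m m' : memory) :
  (k <= k')%nat -> reaches P k pc m pc' m' -> reaches P k' pc m pc' m'.
Proof. intros Hk (j & Hj & R). exists j. split; [lia|exact R]. Qed.

Lemma reaches_step (P : program) (pc : nat) (m : memory) (ins : instr) :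
  nth_error P pc = Some ins ->
  reaches P 1 pc m (fst (step ins pc m)) (snd (step ins pc m)).
Proof. intros H. exists 1%nat. split; [lia|]. intros f. now apply run_step. Qed.

Lemma reaches_halt (P : program) (k fuel pc pc' : nat) (m m' : memory) :
  reaches P k pc m pc' m' -> nth_error P pc' = None -> (k <= fuel)%nat ->
  run P fuel pc m = Some m'.
Proof.
  intros (j & Hj & R) Hn Hf. replace fuel with (j + (fuel - j))%nat by lia.
  rewrite R. now apply run_halt.
Qed.

Lemma Qle_bool_refl (x : Q) : Qle_bool x x = true.
Proof. apply Qle_bool_iff, Qle_refl. Qed.

Lemma reaches_jump (P : program) (pc a t : nat) (m : memory) :
  nth_error P pc = Some (IJle a a t) -> reaches P 1 pc m t m.
Proof.
  intros H. apply (reaches_step _ _ m) in H. cbn [step fst snd] in H.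
  now rewrite Qle_bool_refl in H.
Qed.

(** All compiled jumps go forward, so each instruction runs at most once and [size] bounds the
    time. *)
Lemma compile_correct (P : program) (c : code) :
  structured c = true ->
  forall pc m, code_at P pc (compile pc c) ->
  reaches P (size c) pc m (pc + size c) (exec c m).
Proof.
  induction c as [|ins|c1 IH1 c2 IH2|a b c1 IH1 c2 IH2]; intros Hs pc m Hc;
    cbn [compile size exec structured] in *.
  - rewrite Nat.add_0_r. apply reaches_refl.
  - apply code_at_cons in Hc. destruct Hc as [Hc _].
    apply (reaches_step _ _ m) in Hc. destruct ins; try discriminate;
      cbn [step fst snd] in *; now rewrite Nat.add_1_r.
  - apply andb_prop in Hs. destruct Hs as [Hs1 Hs2].
    apply code_at_app in Hc. rewrite length_compile in Hc. destruct Hc as [Hc1 Hc2].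
    rewrite Nat.add_assoc. eapply reaches_trans; [now apply IH1|now apply IH2].
  - apply andb_prop in Hs. destruct Hs as [Hs1 Hs2].
    apply code_at_cons in Hc. destruct Hc as [Ht Hc].
    apply code_at_app in Hc. rewrite length_compile in Hc. destruct Hc as [Hc2 Hc].
    apply code_at_cons in Hc. destruct Hc as [He Hc1].
    replace (pc + 1 + size c2 + 1)%nat with (pc + 2 + size c2)%nat in Hc1 by lia.
    apply (reaches_step _ _ m) in Ht. cbn [step fst snd] in Ht.
    destruct (Qle_bool (m a) (m b)).
    + apply (reaches_weaken _ (1 + size c1)); [lia|].
      replace (pc + (2 + size c1 + size c2))%nat with (pc + 2 + size c2 + size c1)%nat by lia.
      eapply reaches_trans; [exact Ht|now apply IH1].
    + apply (reaches_weaken _ (1 + (size c2 + 1))); [lia|].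
      replace (S pc) with (pc + 1)%nat in Ht by lia.
      eapply reaches_trans; [exact Ht|].
      eapply reaches_trans; [now apply IH2|].
      replace (pc + (2 + size c1 + size c2))%nat with (pc + 2 + size c2 + size c1)%nat by lia.
      now apply reaches_jump with a.
Qed.

(** A successful test skips the exit jump at [pc + 1]; the final instruction jumps back to the
    test. *)
Definition while_le (pc a b : nat) (c : code) : program :=
  IJle a b (pc + 2) :: IJle a a (pc + 3 + size c) :: compile (pc + 2) c ++ [IJle a a pc].

(** Each round costs the test, the body and the jump back; the last 2 pays for the failing test and
    the exit jump. The induction is on the number of rounds left. *)
Lemma while_correct (P : program) (pc a b : nat) (c : code) (T : nat)
    (Inv : nat -> memory -> Prop) :
  structured c = true -> code_at P pc (while_le pc a b c) ->
  (forall t m, (t < T)%nat -> Inv t m ->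
     Qle_bool (m a) (m b) = true /\ Inv (S t) (exec c m)) ->
  (forall m, Inv T m -> Qle_bool (m a) (m b) = false) ->
  forall m, Inv 0%nat m ->
  exists m', Inv T m' /\ reaches P (T * (size c + 2) + 2) pc m (pc + 3 + size c) m'.
Proof.
  intros Hs Hc Hstep Hend.
  apply code_at_cons in Hc. destruct Hc as [H0 Hc].
  apply code_at_cons in Hc. destruct Hc as [H1 Hc].
  apply code_at_app in Hc. rewrite length_compile in Hc. destruct Hc as [H2 H3].
  apply code_at_cons in H3. destruct H3 as [H3 _].
  replace (pc + 1 + 1)%nat with (pc + 2)%nat in * by lia.
  assert (Hloop : forall u t m, (u + t = T)%nat -> Inv t m ->
    exists m', Inv T m' /\ reaches P (u * (size c + 2) + 2) pc m (pc + 3 + size c) m').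
  { induction u as [|u IH]; intros t m Ht Hm;
      pose proof (reaches_step _ _ m _ H0) as R0; cbn [step fst snd] in R0.
    - cbn in Ht; subst t. rewrite (Hend m Hm) in R0. exists m. split; [exact Hm|].
      replace (S pc) with (pc + 1)%nat in R0 by lia.
      apply (reaches_weaken _ (1 + 1)); [lia|]. eapply reaches_trans; [exact R0|].
      now apply reaches_jump with a.
    - destruct (Hstep t m) as [Hle Hm']; [lia|exact Hm|]. rewrite Hle in R0.
      destruct (IH (S t) (exec c m)) as (m' & HT & R); [lia|exact Hm'|].
      exists m'. split; [exact HT|].
      apply (reaches_weaken _ (1 + (size c + (1 + (u * (size c + 2) + 2))))); [lia|].
      eapply reaches_trans; [exact R0|].
      eapply reaches_trans; [now apply compile_correct|].
      eapply reaches_trans; [apply reaches_jump with a; exact H3|exact R]. }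
  intros m Hm. apply (Hloop T 0%nat m); [lia|exact Hm].
Qed.

Fixpoint writes (c : code) : list nat :=
  match c with
  | Do (IConst d _) | Do (IOp _ d _ _) | Do (ILoad d _) => [d]
  | Skip | Do _ => []
  | Seq c1 c2 | IfLe _ _ c1 c2 => writes c1 ++ writes c2
  end.

Fixpoint store_free (c : code) : bool :=
  match c with
  | Do (IStore _ _) => false
  | Skip | Do _ => true
  | Seq c1 c2 | IfLe _ _ c1 c2 => store_free c1 && store_free c2
  end.

(** Turns preservation of a register into a computable check on the list of written registers. *)
Lemma exec_frame (c : code) (m : memory) (a : nat) :
  store_free c = true -> ~ In a (writes c) -> exec c m a = m a.
Proof.
  revert m; induction c as [|ins|c1 IH1 c2 IH2|x y c1 IH1 c2 IH2]; intros m Hs Ha;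
    cbn [exec writes store_free] in *.
  - reflexivity.
  - destruct ins; try discriminate; cbn [step snd]; unfold upd;
      try reflexivity; cbn in Ha;
      (destruct (Nat.eqb_spec a d); [intuition congruence|reflexivity]).
  - apply andb_prop in Hs. destruct Hs. rewrite in_app_iff in Ha.
    rewrite IH2, IH1; tauto.
  - apply andb_prop in Hs. destruct Hs. rewrite in_app_iff in Ha.
    destruct (Qle_bool _ _); [apply IH1|apply IH2]; tauto.
Qed.

(** * The program *)

Local Open Scope code_scope.

(* rItem holds 2k+2 for the agent k = n-d of the current layer d, so that
   rItem+1 and rItem+2 are the input addresses of l_k and w_k; rAgent and rItem0
   hold the values of rItem for k = i and k = n.  Items with rItem <= rMoved have
   been moved up by rOff.  rStrL, rStrS, rStrD are the table strides. *)
Local Notation rN := 0%nat.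
Local Notation rPtr := 1%nat.
Local Notation rOne := 2%nat.
Local Notation rBin := 3%nat.
Local Notation rMax := 4%nat.
Local Notation rAgent := 5%nat.
Local Notation rOff := 6%nat.
Local Notation rStrL := 7%nat.
Local Notation rStrS := 8%nat.
Local Notation rStrD := 9%nat.
Local Notation rTop := 10%nat.
Local Notation rItem := 11%nat.
Local Notation rS := 12%nat.
Local Notation rL := 13%nat.
Local Notation rV := 14%nat.
Local Notation rCoef := 15%nat.
Local Notation rLen := 16%nat.
Local Notation rWt := 17%nat.
Local Notation rOwn := 18%nat.
Local Notation rChild := 19%nat.
Local Notation rTmp := 20%nat.
Local Notation rVal := 21%nat.
Local Notation rTmp' := 22%nat.
Local Notation rItem0 := 23%nat.
Local Notation rMoved := 24%nat.

Local Notation add d a b := (Do (IOp OAdd d a b)).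
Local Notation sub d a b := (Do (IOp OSub d a b)).
Local Notation mul d a b := (Do (IOp OMul d a b)).
Local Notation quo d a b := (Do (IOp ODiv d a b)).
Local Notation set d q := (Do (IConst d q)).
Local Notation load d a := (Do (ILoad d a)).
Local Notation store a s := (Do (IStore a s)).

Definition spill (t : nat) : code := add rPtr rPtr rOne ;; store rPtr t.

(* With n = mem[0], the address lbin + 32 n lies beyond the input and beyond
   register 24, and lbin can be recovered from it. *)
Definition relocate : code :=
  seqs (repeat (add rPtr rPtr rN) 32) ;;
  store rPtr rOne ;;
  set rOne (Qnat 1) ;;
  seqs (map spill (seq 3 22)).

Definition locate : code :=
  set rOff (Qnat 24) ;; sub rOff rPtr rOff ;;
  set rTmp (Qnat 2) ;; add rTmp' rOff rTmp ;; load rAgent rTmp'.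

(* Register rMax still holds its input, w_0, when it is first read. *)
Definition setup : code :=
  add rAgent rAgent rAgent ;; add rAgent rAgent rTmp ;;
  add rItem0 rN rN ;; add rItem0 rItem0 rTmp ;;
  set rBin (Qnat 32) ;; mul rBin rBin rN ;; sub rBin rTmp' rBin ;;
  mul rMax rBin rMax ;;
  add rTop rBin rOne ;;
  add rStrL rMax rOne ;;
  add rStrS rTop rOne ;; mul rStrS rStrS rStrL ;;
  add rStrD rN rOne ;; mul rStrD rStrD rStrS ;;
  add rPtr rPtr rOne ;;
  set rMoved (Qnat 22) ;;
  set rS (Qnat 0) ;; set rL (Qnat 0) ;; set rV (Qnat 0) ;;
  add rItem rItem0 rS ;;
  quo rCoef rOne rN.

(* If all weights vanish the time budget is constant, so the loop must not run;
   finish then reads the untouched cell at rPtr. *)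
Definition guard : code :=
  IfLe rOne rMax Skip (set rItem (Qnat 0) ;; set rStrD (Qnat 0)).

(** [rOwn] is the cell of the previous layer with the same (s, L, V), and [rChild] the one with the
    state after [absorb]. On overflow L is raised to lbin + 1 and V to the maximum. The shift of s
    is left to [combine]. *)
Definition child : code :=
  sub rOwn rPtr rStrD ;;
  add rTmp rL rLen ;;
  IfLe rTmp rBin
    (add rChild rOwn rWt ;; mul rTmp rLen rStrL ;; add rChild rChild rTmp)
    (sub rTmp rTop rL ;; mul rTmp rTmp rStrL ;; add rChild rOwn rTmp ;;
     IfLe rWt rV Skip (add rChild rChild rWt ;; sub rChild rChild rV)).

(** Two opposite comparisons test whether the current agent is [i]; only other agents move on to s +
    1. *)
Definition combine : code :=
  load rOwn rOwn ;;
  let include := add rChild rChild rStrS ;; load rVal rChild ;; add rVal rVal rOwn in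
  IfLe rItem rAgent
    (IfLe rAgent rItem (load rVal rChild ;; sub rVal rVal rOwn) include)
    include.

Definition evaluate : code :=
  IfLe rItem0 rItem (mul rVal rCoef rV) (child ;; combine).

Definition fetch : code :=
  add rTmp rItem rOne ;;
  IfLe rItem rMoved (add rTmp rTmp rOff) Skip ;;
  load rLen rTmp ;; add rTmp rTmp rOne ;; load rWt rTmp.

Definition advance : code :=
  add rPtr rPtr rOne ;; add rV rV rOne ;;
  IfLe rV rMax Skip (
    set rV (Qnat 0) ;; add rL rL rOne ;;
    IfLe rL rTop Skip (
      set rL (Qnat 0) ;; add rS rS rOne ;;
      IfLe rS rN
        (mul rCoef rCoef rS ;; sub rTmp rN rS ;; quo rCoef rCoef rTmp)
        (set rS (Qnat 0) ;; quo rCoef rOne rN ;;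
         set rTmp (Qnat 2) ;; sub rItem rItem rTmp ;; fetch))).

Definition body : code := evaluate ;; store rPtr rVal ;; advance.

Definition finish : code := sub rPtr rPtr rStrD ;; load rN rPtr.

Definition prologue : code := relocate ;; locate ;; setup ;; guard.

Definition prog : program :=
  compile 0 prologue ++
  while_le (size prologue) rOne rItem body ++
  compile (size prologue + 3 + size body) finish.

(** * Layout of the table and its reachable cells *)

Section Correctness.
Variables (items : list (nat * nat)) (lbin i : nat).
Notation n := (length items).
Notation len := (len items).
Notation wt := (wt items).
Notation coef := (shapley_coef items).
Notation contrib := (contribution items lbin i).

Hypothesis len_bounds : forall k, (k < n)%nat -> (0 < len k)%nat /\ (len k <= lbin)%nat.
Hypothesis ratio_sorted : forall k k', (k < k')%nat -> (k' < n)%nat ->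
  ratio items k' <= ratio items k.
Hypothesis agent_lt : (i < n)%nat.

(* The first item has the largest density and length at least 1, so no feasible
   set weighs more. *)
Definition vmax : nat := lbin * wt 0.
Definition start : nat := lbin + 32 * n.
(** Cell [start] keeps the input [i], and the next 22 cells receive registers 3 to 24. *)
Definition base : nat := start + 23.
Definition strL : nat := S vmax.
Definition strS : nat := (lbin + 2) * strL.
Definition strD : nat := (n + 1) * strS.
Definition flat (d s L V : nat) : nat := d * strD + s * strS + L * strL + V.

(** Registers 3 to 24 hold exactly the first eleven items, so no pair is split; register 3 moves to
    [start + 1], hence the offset [start - 2]. *)
Definition item_addr (k : nat) : nat :=
  if Nat.leb (2 * k + 2) 22 then 2 * k + 3 + (start - 2) else 2 * k + 3.

Record consts (m : memory) : Prop := {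
  c_n : m rN = Qnat n;
  c_one : m rOne = Qnat 1;
  c_bin : m rBin = Qnat lbin;
  c_max : m rMax = Qnat vmax;
  c_agent : m rAgent = Qnat (2 * i + 2);
  c_off : m rOff = Qnat (start - 2);
  c_strL : m rStrL = Qnat strL;
  c_strS : m rStrS = Qnat strS;
  c_strD : m rStrD = Qnat strD;
  c_top : m rTop = Qnat (S lbin);
  c_item0 : m rItem0 = Qnat (2 * n + 2);
  c_moved : m rMoved = Qnat 22;
  c_items : forall k, (k < n)%nat ->
    m (item_addr k) = Qnat (len k) /\ m (S (item_addr k)) = Qnat (wt k) }.

(** At s = n the coefficient has been divided by n - n, so nothing is claimed about it; layers 0 and
    n + 1 have no agent to fetch. *)
Record cursor (d s L V : nat) (m : memory) : Prop := {
  u_ptr : m rPtr = Qnat (base + flat d s L V);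
  u_item : m rItem = Qnat (2 * n + 2 - 2 * d);
  u_s : m rS = Qnat s;
  u_L : m rL = Qnat L;
  u_V : m rV = Qnat V;
  u_coef : (s < n)%nat -> m rCoef == coef s;
  u_fetched : (0 < d <= n)%nat -> m rLen = Qnat (len (n - d)) /\ m rWt = Qnat (wt (n - d)) }.

(* The states for which the table is claimed to be right; other cells hold junk.
   Agent i is not counted in s, whence the two cases of r_s. *)
Record reachable (d s L V : nat) : Prop := {
  r_d : (d <= n)%nat;
  r_s : (if Nat.leb n (i + d) then s + d <= n else s + d < n)%nat;
  r_L : (L <= S lbin)%nat;
  r_V : (V <= vmax)%nat;
  r_density : (L <= lbin)%nat -> (V * len 0 <= L * wt 0)%nat }.

Definition table (t : nat) (m : memory) : Prop :=
  forall d s L V, reachable d s L V -> (flat d s L V < t)%nat ->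
  m (base + flat d s L V)%nat == contrib d s L V.

Lemma base_ge : (25 <= base)%nat.
Proof. unfold base, start. lia. Qed.

Lemma item_density (k : nat) : (k < n)%nat -> (wt k * len 0 <= wt 0 * len k)%nat.
Proof.
  intros Hk. destruct k as [|k]; [lia|].
  apply ratio_cross; [apply len_bounds; lia..|]. apply ratio_sorted; lia.
Qed.

Lemma wt_le_vmax (k : nat) : (k < n)%nat -> (wt k <= vmax)%nat.
Proof.
  intros Hk. pose proof (item_density k Hk). pose proof (len_bounds k Hk).
  assert (Hl0 : (0 < len 0)%nat) by (apply len_bounds; lia). unfold vmax. nia.
Qed.

Lemma reachable_skip (d s L V : nat) :
  reachable (S d) s L V -> reachable d s L V.
Proof.
  intros [Hd Hs HL HV Hr]. split; auto; [lia|].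
  destruct (Nat.leb_spec n (i + d)), (Nat.leb_spec n (i + S d)); lia.
Qed.

(** For an agent that fits, its density bound adds to that of the state; with L at most [lbin] and
    [len 0] at least 1 this yields V at most [vmax]. After a stop, V is a maximum of two values
    below [vmax]. *)
Lemma reachable_take (d s L V L' V' : nat) :
  reachable (S d) s L V -> absorb items lbin (L, V) (n - S d) = (L', V') ->
  reachable d (if Nat.eqb (n - S d) i then s else S s) L' V'.
Proof.
  intros [Hd Hs HL HV Hr] Ha. cbn [absorb] in Ha.
  assert (Hk : (n - S d < n)%nat) by lia.
  pose proof (item_density _ Hk). pose proof (len_bounds _ Hk).
  pose proof (wt_le_vmax _ Hk).
  assert (Hl0 : (0 < len 0)%nat) by (apply len_bounds; lia).
  assert (Hs' : (if Nat.leb n (i + d)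
    then (if Nat.eqb (n - S d) i then s else S s) + d <= n
    else (if Nat.eqb (n - S d) i then s else S s) + d < n)%nat).
  { destruct (Nat.eqb_spec (n - S d) i) as [He|He], (Nat.leb_spec n (i + d)),
      (Nat.leb_spec n (i + S d)); lia. }
  destruct (Nat.leb_spec (L + len (n - S d)) lbin); injection Ha as <- <-.
  - assert (Hden : ((V + wt (n - S d)) * len 0 <= (L + len (n - S d)) * wt 0)%nat).
    { specialize (Hr ltac:(lia)). nia. }
    split; auto; try lia.
    assert ((L + len (n - S d)) * wt 0 <= vmax)%nat
      by (unfold vmax; now apply Nat.mul_le_mono_r). nia.
  - split; auto; lia.
Qed.

Lemma flat_inj (d s L V d' s' L' V' : nat) :
  (s <= n)%nat -> (L <= S lbin)%nat -> (V <= vmax)%nat ->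
  (s' <= n)%nat -> (L' <= S lbin)%nat -> (V' <= vmax)%nat ->
  flat d s L V = flat d' s' L' V' -> d = d' /\ s = s' /\ L = L' /\ V = V'.
Proof.
  intros Hs HL HV Hs' HL' HV' H.
  (* Horner form of a mixed-radix number with radices vmax + 1, lbin + 2 and n + 1; the digits are
     then peeled off by uniqueness of division. *)
  assert (Hh : forall a s L V, flat a s L V = (strL * ((lbin + 2) * ((n + 1) * a + s) + L) + V)%nat)
    by (intros; unfold flat, strD, strS; ring).
  rewrite !Hh in H. clear Hh.
  apply Nat.div_mod_unique in H; [|unfold strL; lia..]. destruct H as [H <-].
  apply Nat.div_mod_unique in H; [|lia..]. destruct H as [H <-].
  apply Nat.div_mod_unique in H; [|lia..]. destruct H as [<- <-]. auto.
Qed.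

Lemma consts_frame (m m' : memory) :
  (forall a, In a [rN; rOne; rBin; rMax; rAgent; rOff; rStrL; rStrS; rStrD; rTop; rItem0; rMoved]
     \/ (25 <= a < base)%nat -> m' a = m a) ->
  consts m -> consts m'.
Proof.
  intros Hf [].
  assert (Hi : forall k, (k < n)%nat -> (25 <= item_addr k /\ S (item_addr k) < base)%nat).
  { intros k Hk. unfold item_addr, base, start.
    destruct (Nat.leb_spec (2 * k + 2) 22); lia. }
  split; try (rewrite Hf; [assumption|left; cbn; tauto]).
  intros k Hk. specialize (Hi k Hk). rewrite !Hf by (right; lia). auto.
Qed.

Lemma consts_exec (c : code) (m : memory) :
  store_free c = true ->
  forallb (fun a => existsb (Nat.eqb a)
    [rPtr; rItem; rS; rL; rV; rCoef; rLen; rWt; rOwn; rChild; rTmp; rVal; rTmp']) (writes c) = true ->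
  consts m -> consts (exec c m).
Proof.
  intros Hs Hw. apply consts_frame. intros a Ha. apply exec_frame; [exact Hs|].
  intros Hin. rewrite forallb_forall in Hw. specialize (Hw a Hin).
  apply existsb_exists in Hw. destruct Hw as (b & Hb & He). apply Nat.eqb_eq in He. subst b.
  cbn in Ha, Hb. intuition (subst; try discriminate; lia).
Qed.

(** * One round of the loop *)

Ltac known Hc Hu :=
  rewrite ?(c_n _ Hc), ?(c_one _ Hc), ?(c_bin _ Hc), ?(c_max _ Hc), ?(c_agent _ Hc),
    ?(c_off _ Hc), ?(c_strL _ Hc), ?(c_strS _ Hc), ?(c_strD _ Hc), ?(c_top _ Hc),
    ?(c_item0 _ Hc), ?(c_moved _ Hc),
    ?(u_ptr _ _ _ _ _ Hu), ?(u_item _ _ _ _ _ Hu), ?(u_s _ _ _ _ _ Hu),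
    ?(u_L _ _ _ _ _ Hu), ?(u_V _ _ _ _ _ Hu).

Ltac compute_exec := cbn [exec step snd fst upd Nat.eqb eval_op].
Ltac qnat := repeat progress rewrite ?Qnat_add, ?Qnat_mul, ?Qnat_leb, ?addr_Qnat.

Lemma child_spec (d s L V L' V' : nat) (m : memory) :
  consts m -> cursor (S d) s L V m -> (d < n)%nat -> (L <= S lbin)%nat ->
  absorb items lbin (L, V) (n - S d) = (L', V') ->
  exec child m rOwn = Qnat (base + flat d s L V)
  /\ exec child m rChild = Qnat (base + flat d s L' V').
Proof.
  intros Hc Hu Hd HL Ha. destruct (u_fetched _ _ _ _ _ Hu ltac:(lia)) as [Hlen Hwt].
  assert (Hown : (base + flat (S d) s L V - strD = base + flat d s L V)%nat)
    by (unfold flat; lia).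
  assert (Hge : (strD <= base + flat (S d) s L V)%nat) by (unfold flat; lia).
  unfold child. compute_exec. known Hc Hu. rewrite ?Hlen. qnat.
  cbn [absorb] in Ha.
  destruct (Nat.leb_spec (L + len (n - S d)) lbin); injection Ha as <- <-.
  - compute_exec. known Hc Hu. rewrite ?Hlen, ?Hwt. rewrite Qnat_sub, Hown by exact Hge. qnat.
    split; [reflexivity|]. f_equal. unfold flat. lia.
  - compute_exec. known Hc Hu. rewrite ?Hwt. qnat.
    (* Ensures that the truncated subtraction raising L to lbin + 1 agrees with the rational one. *)
    assert (HLs : (L * strL <= S lbin * strL)%nat) by now apply Nat.mul_le_mono_r.
    destruct (Nat.leb_spec (wt (n - S d)) V); compute_exec; known Hc Hu; rewrite ?Hwt;
      rewrite (Qnat_sub _ strD), Hown, (Qnat_sub (S lbin)) by assumption; qnat;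
      rewrite Nat.mul_sub_distr_r; qnat.
    + split; [reflexivity|]. f_equal. unfold flat. lia.
    + rewrite Qnat_sub by lia. split; [reflexivity|]. f_equal. unfold flat. lia.
Qed.

Lemma consts_upd (a : nat) (x : Q) (m : memory) :
  existsb (Nat.eqb a)
    [rPtr; rItem; rS; rL; rV; rCoef; rLen; rWt; rOwn; rChild; rTmp; rVal; rTmp'] = true ->
  consts m -> consts (upd m a x).
Proof.
  intros Hw. apply (consts_exec (Do (IConst a x)) m); [reflexivity|].
  cbn [writes forallb]. now rewrite Hw.
Qed.

Ltac heap_addresses :=
  repeat match goal with
  | |- context [Nat.eqb ?x ?y] =>
      replace (Nat.eqb x y) with false by (symmetry; apply Nat.eqb_neq; lia)
  end; cbv iota.

Lemma combine_spec (k a b : nat) (m : memory) :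
  consts m -> m rItem = Qnat (2 * k + 2) -> m rOwn = Qnat a -> m rChild = Qnat b ->
  (25 <= a)%nat -> (25 <= b)%nat ->
  exec combine m rVal =
  if Nat.eqb k i then m b - m a else m (b + strS)%nat + m a.
Proof.
  intros Hc Hk Ha Hb Ha25 Hb25. unfold combine. compute_exec.
  rewrite !(c_agent _ Hc), !(c_strS _ Hc), !Hk, !Ha, !Hb. qnat.
  unfold upd. cbn [Nat.eqb].
  destruct (Nat.eqb_spec k i) as [He|He],
    (Nat.leb_spec (2 * k + 2) (2 * i + 2)), (Nat.leb_spec (2 * i + 2) (2 * k + 2));
    try lia; cbn [Nat.eqb]; heap_addresses; reflexivity.
Qed.

Lemma flat_lt (d s L V : nat) :
  (s <= n)%nat -> (L <= S lbin)%nat -> (V <= vmax)%nat -> (flat d s L V < S d * strD)%nat.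
Proof.
  intros Hs HL HV.
  assert (L * strL <= S lbin * strL)%nat by now apply Nat.mul_le_mono_r.
  assert (s * strS <= n * strS)%nat by now apply Nat.mul_le_mono_r.
  assert (L * strL + V < strS)%nat
    by (unfold strS; replace (lbin + 2)%nat with (S (S lbin)) by lia; unfold strL in *; lia).
  unfold flat, strD. lia.
Qed.

Lemma reachable_s (d s L V : nat) : reachable d s L V -> (s <= n)%nat.
Proof. intros [_ Hs _ _ _]. destruct (Nat.leb n (i + d)); lia. Qed.

Lemma evaluate_spec (d s L V : nat) (m : memory) :
  consts m -> cursor d s L V m -> table (flat d s L V) m -> reachable d s L V ->
  exec evaluate m rVal == contrib d s L V.
Proof.
  intros Hc Hu Ht Hr. unfold evaluate. cbn [exec]. known Hc Hu. qnat.
  destruct d as [|d].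
  - rewrite Nat.mul_0_r, Nat.sub_0_r, Nat.leb_refl. compute_exec. known Hc Hu.
    cbn [contribution]. rewrite (u_coef _ _ _ _ _ Hu); [reflexivity|].
    destruct Hr as [_ Hs _ _ _]. destruct (Nat.leb_spec n (i + 0)); lia.
  - pose proof (r_d _ _ _ _ Hr) as Hd.
    destruct (Nat.leb_spec (2 * n + 2) (2 * n + 2 - 2 * S d)); [lia|].
    destruct (absorb items lbin (L, V) (n - S d)) as [L' V'] eqn:Ha.
    destruct (child_spec d s L V L' V' m Hc Hu Hd (r_L _ _ _ _ Hr) Ha) as [Hown Hchild].
    assert (Hitem : exec child m rItem = Qnat (2 * (n - S d) + 2)).
    { rewrite (exec_frame child) by (reflexivity || (cbn; lia)).
      known Hc Hu. f_equal. lia. }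
    assert (Hheap : forall a, (25 <= a)%nat -> exec child m a = m a)
      by (intros a Ha25; apply exec_frame; [reflexivity|cbn; lia]).
    rewrite (combine_spec (n - S d) _ _ _ (consts_exec child m eq_refl eq_refl Hc)
      Hitem Hown Hchild) by (pose proof base_ge; lia).
    rewrite !Hheap by (pose proof base_ge; lia).
    pose proof (reachable_skip _ _ _ _ Hr) as Hskip.
    pose proof (reachable_take _ _ _ _ _ _ Hr Ha) as Htake.
    (* Every cell of layer d precedes every cell of layer d + 1, so both values read are already in
       the table. *)
    assert (Hlt : forall s0 L0 V0, reachable d s0 L0 V0 ->
              m (base + flat d s0 L0 V0)%nat == contrib d s0 L0 V0).
    { intros s0 L0 V0 H0. apply Ht; [exact H0|].
      pose proof (flat_lt d s0 L0 V0 (reachable_s _ _ _ _ H0) (r_L _ _ _ _ H0) (r_V _ _ _ _ H0)).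
      unfold flat at 2. lia. }
    cbn [contribution]. rewrite Ha.
    destruct (Nat.eqb (n - S d) i).
    + now rewrite (Hlt _ _ _ Hskip), (Hlt _ _ _ Htake).
    + replace (base + flat d s L' V' + strS)%nat with (base + flat d (S s) L' V')%nat
        by (unfold flat; lia).
      rewrite (Hlt _ _ _ Hskip), (Hlt _ _ _ Htake). ring.
Qed.

Lemma fetch_spec (k : nat) (m : memory) :
  consts m -> m rItem = Qnat (2 * k + 2) -> (k < n)%nat ->
  exec fetch m rLen = Qnat (len k) /\ exec fetch m rWt = Qnat (wt k).
Proof.
  intros Hc Hk Hkn. destruct (c_items _ Hc k Hkn) as [Hl Hw].
  unfold fetch. compute_exec. rewrite !Hk, !(c_one _ Hc), !(c_moved _ Hc), !(c_off _ Hc).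
  change 1 with (Qnat 1). qnat.
  assert (Hge : (25 <= item_addr k)%nat)
    by (unfold item_addr, start; destruct (Nat.leb_spec (2 * k + 2) 22); lia).
  unfold item_addr in Hl, Hw, Hge.
  destruct (Nat.leb (2 * k + 2) 22); compute_exec; rewrite ?Hk, ?(c_one _ Hc);
    change 1 with (Qnat 1); qnat; unfold upd; heap_addresses.
  - split; [rewrite <- Hl|rewrite <- Hw]; f_equal; lia.
  - split; [rewrite <- Hl|rewrite <- Hw]; f_equal; lia.
Qed.

Lemma advance_spec (d s L V : nat) (m : memory) :
  consts m -> cursor d s L V m ->
  (d <= n)%nat -> (s <= n)%nat -> (L <= S lbin)%nat -> (V <= vmax)%nat ->
  exists d' s' L' V',
    (s' <= n /\ L' <= S lbin /\ V' <= vmax)%nat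
    /\ flat d' s' L' V' = S (flat d s L V)
    /\ cursor d' s' L' V' (exec advance m).
Proof.
  intros Hc Hu Hd Hs HL HV. unfold advance. compute_exec. known Hc Hu.
  qnat.
  destruct (Nat.leb_spec (V + 1) vmax).
  { exists d, s, L, (V + 1)%nat. split; [lia|]. split; [unfold flat; lia|].
    destruct Hu. split; compute_exec; auto. f_equal. unfold flat. lia. }
  assert (V = vmax) by lia; subst V.
  compute_exec. known Hc Hu. qnat.
  destruct (Nat.leb_spec (L + 1) (S lbin)).
  { exists d, s, (L + 1)%nat, 0%nat.
    assert (Hf : flat d s (L + 1) 0 = S (flat d s L vmax)) by (unfold flat, strL; lia).
    split; [lia|]. split; [exact Hf|].
    destruct Hu. split; compute_exec; auto. f_equal. lia. }
  assert (L = S lbin) by lia; subst L.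
  compute_exec. known Hc Hu. qnat.
  destruct (Nat.leb_spec (s + 1) n).
  { exists d, (s + 1)%nat, 0%nat, 0%nat.
    assert (Hf : flat d (s + 1) 0 0 = S (flat d s (S lbin) vmax))
      by (unfold flat, strS, strL; lia).
    split; [lia|]. split; [exact Hf|].
    pose proof (u_coef _ _ _ _ _ Hu) as Hcoef.
    destruct Hu. split; compute_exec; auto.
    - f_equal. lia.
    - intros Hlt. rewrite Qnat_sub by lia. rewrite Hcoef by lia.
      rewrite Nat.add_1_r in *. symmetry. now apply shapley_coef_S. }
  assert (s = n) by lia; subst s.
  exists (S d), 0%nat, 0%nat, 0%nat.
  assert (Hf : flat (S d) 0 0 0 = S (flat d n (S lbin) vmax))
    by (unfold flat, strD, strS, strL; lia).
  split; [lia|]. split; [exact Hf|].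
  (* Isolates the memory before [fetch]: the fetched pair comes from [fetch_spec], all other fields
     from the frame lemma. *)
  match goal with |- cursor _ _ _ _ (exec fetch ?x) => set (m' := x) end.
  assert (Hitem : m' rItem = Qnat (2 * n + 2 - 2 * S d)).
  { unfold m'. compute_exec. known Hc Hu. rewrite Qnat_sub by lia. f_equal. lia. }
  assert (Hc' : consts m') by (repeat (apply consts_upd; [reflexivity|]); exact Hc).
  split.
  1-6: rewrite (exec_frame fetch) by (reflexivity || (cbn; lia)).
  - unfold m'. compute_exec. f_equal. lia.
  - exact Hitem.
  - reflexivity.
  - reflexivity.
  - reflexivity.
  - intros _. unfold m'. compute_exec. known Hc Hu. symmetry.
    apply shapley_coef_0. lia.
  - intros Hlt. apply fetch_spec; [exact Hc'| |lia]. rewrite Hitem. f_equal. lia.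
Qed.

Definition loop_inv (t : nat) (m : memory) : Prop :=
  consts m /\ table t m /\
  exists d s L V, (s <= n /\ L <= S lbin /\ V <= vmax)%nat
    /\ flat d s L V = t /\ cursor d s L V m.

Lemma cursor_frame (d s L V : nat) (m m' : memory) :
  (forall a, In a [rPtr; rItem; rS; rL; rV; rCoef; rLen; rWt] -> m' a = m a) ->
  cursor d s L V m -> cursor d s L V m'.
Proof. intros Hf []. split; rewrite ?Hf by (cbn; tauto); auto. Qed.

Lemma table_frame (t : nat) (m m' : memory) :
  (forall a, (25 <= a)%nat -> m' a = m a) -> table t m -> table t m'.
Proof.
  intros Hf Ht d s L V Hr Hlt. rewrite Hf by (pose proof base_ge; lia). now apply Ht.
Qed.

Lemma body_spec (t : nat) (m : memory) :
  (t < (n + 1) * strD)%nat -> loop_inv t m ->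
  Qle_bool (m rOne) (m rItem) = true /\ loop_inv (S t) (exec body m).
Proof.
  intros Hlt (Hc & Ht & d & s & L & V & (Hs & HL & HV) & Hf & Hu).
  (* [rItem] holds 2n + 2 - 2d, which is at least 2 as long as d is at most n, so the loop test
     succeeds. *)
  assert (Hd : (d <= n)%nat).
  { destruct (Nat.le_gt_cases d n) as [|Hgt]; [assumption|].
    assert ((n + 1) * strD <= d * strD)%nat by (apply Nat.mul_le_mono_r; lia).
    unfold flat in Hf. lia. }
  split; [known Hc Hu; rewrite Qnat_leb; apply Nat.leb_le; lia|].
  unfold body. cbn [exec]. set (m1 := exec evaluate m).
  assert (Hc1 : consts m1) by now apply consts_exec.
  assert (Hu1 : cursor d s L V m1).
  { apply (cursor_frame _ _ _ _ m); [|exact Hu]. intros a Ha.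
    apply exec_frame; [reflexivity|]. cbn in Ha |- *. lia. }
  assert (Hheap1 : forall a, (25 <= a)%nat -> m1 a = m a)
    by (intros a Ha; apply exec_frame; [reflexivity|cbn; lia]).
  cbn [step snd]. rewrite (u_ptr _ _ _ _ _ Hu1), addr_Qnat, Hf.
  set (m2 := upd m1 (base + t) (m1 rVal)).
  assert (Hm2 : forall a, a <> (base + t)%nat -> m2 a = m1 a)
    by (intros a Ha; unfold m2, upd; now destruct (Nat.eqb_spec a (base + t))).
  assert (Hc2 : consts m2).
  { apply (consts_frame m1); [|exact Hc1]. intros a Ha. apply Hm2.
    pose proof base_ge. cbn in Ha. lia. }
  assert (Hu2 : cursor d s L V m2).
  { apply (cursor_frame _ _ _ _ m1); [|exact Hu1]. intros a Ha. apply Hm2.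
    pose proof base_ge. cbn in Ha. lia. }
  assert (Ht2 : table (S t) m2).
  { intros d' s' L' V' Hr Hlt'.
    (* By [flat_inj] the only reachable coordinates at position t are those of the cursor, where the
       new value was just stored. *)
    destruct (Nat.eq_dec (flat d' s' L' V') t) as [He|Hne].
    - pose proof (reachable_s _ _ _ _ Hr).
      destruct (flat_inj d' s' L' V' d s L V) as (-> & -> & -> & ->);
        try assumption; try apply Hr; [congruence|].
      rewrite Hf. unfold m2, upd. rewrite Nat.eqb_refl.
      apply evaluate_spec; auto. now rewrite Hf.
    - rewrite Hm2 by lia. rewrite Hheap1 by (pose proof base_ge; lia). apply Ht; [exact Hr|lia]. }
  destruct (advance_spec d s L V m2) as (d' & s' & L' & V' & Hrange & Hf' & Hu'); auto.
  split; [now apply consts_exec|]. split.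
  - apply (table_frame _ m2); [|exact Ht2]. intros a Ha.
    apply exec_frame; [reflexivity|cbn; lia].
  - exists d', s', L', V'. rewrite Hf', Hf. auto.
Qed.

(** The pointer is now one past layer n, so one layer stride back lies the cell (n, 0, 0, 0). *)
Lemma loop_end (m : memory) :
  loop_inv ((n + 1) * strD) m ->
  Qle_bool (m rOne) (m rItem) = false /\ exec finish m rN == contrib n 0 0 0.
Proof.
  intros (Hc & Ht & d & s & L & V & (Hs & HL & HV) & Hf & Hu).
  assert (Hpos : (0 < strD)%nat) by (unfold strD, strS, strL; lia).
  assert (Hd : (n < d)%nat).
  { destruct (Nat.le_gt_cases d n) as [Hle|]; [|assumption].
    pose proof (flat_lt d s L V Hs HL HV).
    assert (S d * strD <= (n + 1) * strD)%nat by (apply Nat.mul_le_mono_r; lia). lia. }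
  split.
  - known Hc Hu. rewrite Qnat_leb. apply Nat.leb_gt. lia.
  - unfold finish. compute_exec. known Hc Hu. rewrite Hf.
    rewrite Qnat_sub by lia. rewrite addr_Qnat.
    replace (base + (n + 1) * strD - strD)%nat with (base + flat n 0 0 0)%nat
      by (unfold flat; lia).
    pose proof base_ge. unfold upd. heap_addresses.
    apply Ht; [|unfold flat; lia].
    split; try lia. destruct (Nat.leb_spec n (i + n)); lia.
Qed.

(** * Initial memory and set-up *)

Lemma init_mem_item (k : nat) : (k < n)%nat ->
  init_mem items lbin i (2 * k + 3)%nat = Qnat (len k) /\
  init_mem items lbin i (2 * k + 4)%nat = Qnat (wt k).
Proof.
  intros Hk.
  assert (Hn : nth_error items k = Some (len k, wt k)).
  { rewrite (nth_error_nth' _ (0, 0)%nat Hk). unfold Defs.len, Defs.wt.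
    now rewrite <- surjective_pairing. }
  replace (2 * k + 3)%nat with (S (S (S (2 * k)))) by lia.
  replace (2 * k + 4)%nat with (S (S (S (S (2 * k))))) by lia.
  cbn [init_mem]. rewrite Nat.div2_double, Nat.div2_succ_double, Hn.
  rewrite Nat.even_succ, Nat.even_mul, Nat.odd_mul. now split.
Qed.

Lemma init_mem_free (a : nat) : (2 * n + 3 <= a)%nat -> init_mem items lbin i a = 0.
Proof.
  intros Ha. destruct a as [|[|[|b]]]; [lia..|]. cbn [init_mem].
  assert (Hb : (n <= Nat.div2 b)%nat).
  { rewrite Nat.div2_div. apply Nat.div_le_lower_bound; lia. }
  apply nth_error_None in Hb. now rewrite Hb.
Qed.

Lemma exec_repeat_add (j a b : nat) (m : memory) :
  m rN = Qnat a -> m rPtr = Qnat b ->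
  let m' := exec (seqs (repeat (add rPtr rPtr rN) j)) m in
  m' rPtr = Qnat (b + j * a) /\ forall x, x <> rPtr -> m' x = m x.
Proof.
  revert b m; induction j as [|j IH]; intros b m Ha Hb; cbn [repeat seqs fold_right exec].
  - rewrite Nat.add_0_r. auto.
  - cbn [step snd eval_op].
    destruct (IH (b + a)%nat (upd m rPtr (m rPtr + m rN))) as [H1 H2].
    + exact Ha.
    + cbn [upd Nat.eqb]. now rewrite Ha, Hb, Qnat_add.
    + cbv zeta in *. unfold seqs in *. split.
      * rewrite H1. f_equal. lia.
      * intros x Hx. rewrite H2 by exact Hx. unfold upd.
        now destruct (Nat.eqb_spec x rPtr).
Qed.

(** All sources lie below [a] and all targets above it, so no register is overwritten before it is
    copied. *)
Lemma exec_spill (j t a : nat) (m : memory) :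
  m rPtr = Qnat a -> m rOne = Qnat 1 -> (3 <= t)%nat -> (t + j <= a)%nat ->
  let m' := exec (seqs (map spill (seq t j))) m in
  m' rPtr = Qnat (a + j)
  /\ (forall x, (x < j)%nat -> m' (a + 1 + x)%nat = m (t + x)%nat)
  /\ (forall x, x <> rPtr -> ~ (a < x <= a + j)%nat -> m' x = m x).
Proof.
  revert t a m; induction j as [|j IH]; intros t a m Ha H1 Ht Hj;
    cbn [seq map seqs fold_right exec].
  - rewrite Nat.add_0_r. split; [exact Ha|]. split; [lia|auto].
  - set (m1 := exec (spill t) m).
    assert (Hm1 : forall x, m1 x = if Nat.eqb x (a + 1) then m t
                                   else if Nat.eqb x rPtr then Qnat (a + 1) else m x).
    { intros x. unfold m1, spill. compute_exec. rewrite Ha, H1. qnat. unfold upd.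
      destruct (Nat.eqb x (a + 1)); [|reflexivity].
      destruct (Nat.eqb_spec t rPtr); [lia|reflexivity]. }
    destruct (IH (S t) (a + 1)%nat m1) as (E1 & E2 & E3).
    + rewrite Hm1. destruct (Nat.eqb_spec rPtr (a + 1)); [lia|reflexivity].
    + rewrite Hm1. destruct (Nat.eqb_spec rOne (a + 1)); [lia|exact H1].
    + lia.
    + lia.
    + cbv zeta in *. unfold seqs in *. split; [rewrite E1; f_equal; lia|]. split.
      * intros [|x] Hx.
        -- rewrite E3 by lia. rewrite Hm1, !Nat.add_0_r, Nat.eqb_refl. reflexivity.
        -- replace (a + 1 + S x)%nat with (a + 1 + 1 + x)%nat by lia.
           rewrite E2 by lia. rewrite Hm1.
           destruct (Nat.eqb_spec (S t + x) (a + 1)); [lia|].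
           destruct (Nat.eqb_spec (S t + x) rPtr); [lia|]. f_equal. lia.
      * intros x Hx Hr. rewrite E3 by lia. rewrite Hm1.
        destruct (Nat.eqb_spec x (a + 1)); [lia|].
        destruct (Nat.eqb_spec x rPtr); [lia|reflexivity].
Qed.

Record relocated (m : memory) : Prop := {
  l_n : m rN = Qnat n;
  l_ptr : m rPtr = Qnat (start + 22);
  l_one : m rOne = Qnat 1;
  l_wt0 : m rMax = Qnat (wt 0);
  l_agent : m start = Qnat i;
  l_items : forall k, (k < n)%nat ->
    m (item_addr k) = Qnat (len k) /\ m (S (item_addr k)) = Qnat (wt k);
  l_free : forall a, (base <= a)%nat -> m a = 0 }.

Lemma relocate_spec : relocated (exec relocate (init_mem items lbin i)).
Proof.
  pose proof base_ge as Hbase. unfold relocate. cbn [exec].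
  set (m0 := init_mem items lbin i).
  destruct (exec_repeat_add 32 n lbin m0 eq_refl eq_refl) as [H1 H1'].
  set (m1 := exec (seqs (repeat _ 32)) m0) in *. cbv zeta in *.
  fold start in H1. cbn [step snd]. rewrite H1, addr_Qnat.
  (* [rOne] still holds the input [i]; it is saved at [start] before being set to 1. *)
  set (m2 := upd (upd m1 start (m1 rOne)) rOne (Qnat 1)).
  assert (Hstart : (32 <= start /\ 2 * n + 3 <= start)%nat) by (unfold start; lia).
  assert (Hm2 : forall x, x <> rPtr -> x <> rOne -> x <> start -> m2 x = m0 x).
  { intros x Hx Hx' Hx''. unfold m2, upd.
    destruct (Nat.eqb_spec x rOne); [contradiction|].
    destruct (Nat.eqb_spec x start); [contradiction|]. now apply H1'. }
  assert (Hptr : m2 rPtr = Qnat start)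
    by (unfold m2, upd; destruct (Nat.eqb_spec rPtr start); [lia|exact H1]).
  assert (Hone : m2 rOne = Qnat 1) by reflexivity.
  assert (Hagent : m2 start = Qnat i).
  { unfold m2, upd. rewrite Nat.eqb_refl.
    destruct (Nat.eqb_spec start rOne); [lia|]. now apply H1'. }
  clearbody m2.
  destruct (exec_spill 22 3 start m2 Hptr Hone) as (E1 & E2 & E3); [lia..|].
  set (m3 := exec (seqs (map spill (seq 3 22))) m2) in *. cbv zeta in *. clearbody m3.
  destruct (init_mem_item 0 ltac:(lia)) as [_ Hw0].
  split.
  - rewrite E3, Hm2 by lia. reflexivity.
  - exact E1.
  - now rewrite E3 by lia.
  - rewrite E3, Hm2 by lia. exact Hw0.
  - now rewrite E3 by lia.
  - intros k Hk. destruct (init_mem_item k Hk) as [Hl Hw].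
    unfold item_addr. destruct (Nat.leb_spec (2 * k + 2) 22).
    + replace (2 * k + 3 + (start - 2))%nat with (start + 1 + 2 * k)%nat by lia.
      replace (S (start + 1 + 2 * k)) with (start + 1 + (2 * k + 1))%nat by lia.
      rewrite !E2, !Hm2 by lia.
      split; [rewrite <- Hl|rewrite <- Hw]; unfold m0; f_equal; lia.
    + rewrite !E3, !Hm2 by lia.
      split; [exact Hl|rewrite <- Hw; unfold m0; f_equal; lia].
  - intros a Ha. unfold base in Ha. rewrite E3, Hm2 by lia. apply init_mem_free. lia.
Qed.

Lemma exec_op (P : memory -> Prop) (o : binop) (d a b : nat) (m : memory) :
  (forall m', m' d = eval_op o (m a) (m b) ->
     (forall r, Nat.eqb r d = false -> m' r = m r) -> P m') ->
  P (exec (Do (IOp o d a b)) m).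
Proof.
  intros H. apply H; cbn [exec step snd]; unfold upd.
  - now rewrite Nat.eqb_refl.
  - intros r Hr. now rewrite Hr.
Qed.

Lemma exec_const (P : memory -> Prop) (d : nat) (q : Q) (m : memory) :
  (forall m', m' d = q -> (forall r, Nat.eqb r d = false -> m' r = m r) -> P m') ->
  P (exec (Do (IConst d q)) m).
Proof.
  intros H. apply H; cbn [exec step snd]; unfold upd.
  - now rewrite Nat.eqb_refl.
  - intros r Hr. now rewrite Hr.
Qed.

(* Runs the first instruction and restates every known register value for the
   new memory; executing a long sequence by conversion takes exponential time. *)
Ltac forward :=
  match goal with
  | |- _ (exec (Seq ?c1 ?c2) ?m) => rewrite (exec_Seq c1 c2 m)
  | |- _ => idtac
  end;
  match goal with
  | |- context [exec (Do ?ins) ?m] =>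
      is_var m; pattern (exec (Do ins) m);
      let m' := fresh "m" in
      let Hd := fresh "Hd" in
      let Hf := fresh "Hf" in
      (apply exec_op || apply exec_const); intros m' Hd Hf; cbv beta; cbn [eval_op] in Hd;
      repeat match goal with H : m ?r = _ |- _ => rewrite H in Hd end;
      repeat progress rewrite ?Qnat_add, ?Qnat_mul in Hd;
      rewrite ?Qnat_sub in Hd by (unfold start; lia);
      repeat match goal with
      | H : m ?r = _ |- _ => first [rewrite <- (Hf r eq_refl) in H | clear H]
      end;
      clear Hf; try clear m
  end.

(** Stated for an arbitrary [P] so that [forward] can replace each intermediate memory by a fresh
    variable. *)
Lemma setup_spec (P : memory -> Prop) (m : memory) : relocated m ->
  (forall m', m' rN = Qnat n -> m' rOne = Qnat 1 -> m' rBin = Qnat lbin ->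
     m' rMax = Qnat vmax -> m' rAgent = Qnat (2 * i + 2) ->
     m' rOff = Qnat (start - 2) -> m' rStrL = Qnat strL -> m' rStrS = Qnat strS ->
     m' rStrD = Qnat strD -> m' rTop = Qnat (S lbin) ->
     m' rItem0 = Qnat (2 * n + 2) -> m' rMoved = Qnat 22 ->
     m' rPtr = Qnat base -> m' rItem = Qnat (2 * n + 2) -> m' rS = Qnat 0 ->
     m' rL = Qnat 0 -> m' rV = Qnat 0 -> m' rCoef = Qnat 1 / Qnat n -> P m') ->
  P (exec setup (exec locate m)).
Proof.
  intros Hm HP.
  assert (Hstart : (32 <= start)%nat) by (unfold start; lia).
  assert (Hoff : exec locate m rOff = Qnat (start - 2)).
  { unfold locate. compute_exec. rewrite (l_ptr _ Hm), Qnat_sub by lia. f_equal. lia. }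
  assert (Htmp : exec locate m rTmp = Qnat 2) by reflexivity.
  assert (Htmp' : exec locate m rTmp' = Qnat start).
  { unfold locate. compute_exec. rewrite (l_ptr _ Hm), Qnat_sub by lia.
    qnat. f_equal. lia. }
  assert (Hagent : exec locate m rAgent = Qnat i).
  { unfold locate. compute_exec. rewrite (l_ptr _ Hm), Qnat_sub by lia.
    qnat. unfold upd. heap_addresses. rewrite <- (l_agent _ Hm). f_equal. lia. }
  pose proof (l_n _ Hm) as Hn. change (exec locate m rN = Qnat n) in Hn.
  pose proof (l_ptr _ Hm) as Hptr. change (exec locate m rPtr = Qnat (start + 22)) in Hptr.
  pose proof (l_one _ Hm) as Hone. change (exec locate m rOne = Qnat 1) in Hone.
  pose proof (l_wt0 _ Hm) as Hw. change (exec locate m rMax = Qnat (wt 0)) in Hw.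
  clear Hm. set (m0 := exec locate m) in *. clearbody m0.
  unfold setup. do 7 forward.
  (* The seventh instruction recovers [lbin] in [rBin]; it is simplified here, before entering the
     strides. *)
  replace (start - 32 * n)%nat with lbin in * by (unfold start; lia).
  do 14 forward.
  apply HP; try assumption;
    match goal with H : ?x = _ |- ?x = _ => rewrite H end; f_equal;
    unfold base, strD, strS, strL, vmax; lia.
Qed.

Notation loop_start := (exec prologue (init_mem items lbin i)).

Lemma loop_start_eq : loop_start =
  exec guard (exec setup (exec locate (exec relocate (init_mem items lbin i)))).
Proof.
  unfold prologue.
  now rewrite (exec_Seq relocate), (exec_Seq locate), (exec_Seq setup).
Qed.

Lemma setup_heap (m : memory) (a : nat) :
  (25 <= a)%nat -> exec setup (exec locate m) a = m a.
Proof.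
  intros Ha.
  now rewrite (exec_frame setup), (exec_frame locate) by (reflexivity || (cbn; lia)).
Qed.

Lemma loop_start_inv : (0 < vmax)%nat -> loop_inv 0 loop_start.
Proof.
  intros Hv. rewrite loop_start_eq. pose proof relocate_spec as Hm.
  set (m := exec relocate _) in *. clearbody m.
  assert (Hheap := setup_heap m). revert Hheap. apply setup_spec; [exact Hm|].
  intros m' E0 E2 E3 E4 E5 E6 E7 E8 E9 E10 E23 E24 E1 E11 E12 E13 E14 E15 Hheap.
  assert (Hg : exec guard m' = m').
  { unfold guard. cbn [exec]. rewrite E2, E4, Qnat_leb.
    now destruct (Nat.leb_spec 1 vmax); [|lia]. }
  rewrite Hg. split; [split; auto|split; [intros d s L V _ Hlt; lia|]].
  - intros k Hk. destruct (l_items _ Hm k Hk) as [Hl Hw].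
    assert (25 <= item_addr k)%nat
      by (unfold item_addr, start; destruct (Nat.leb_spec (2 * k + 2) 22); lia).
    rewrite !Hheap by lia. auto.
  - exists 0%nat, 0%nat, 0%nat, 0%nat. split; [lia|]. split; [reflexivity|].
    split; auto; [| | |lia].
    + rewrite E1. f_equal. unfold flat. lia.
    + rewrite E11. f_equal. lia.
    + intros _. rewrite E15. symmetry. apply shapley_coef_0. lia.
Qed.

(** The guard zeroes [rItem], so the loop test fails, and [rStrD], so [finish] reads the cell at
    [base]. That cell is still 0, the right answer since every weight is bounded by [vmax] = 0. *)
Lemma loop_start_degenerate : vmax = 0%nat ->
  Qle_bool (loop_start rOne) (loop_start rItem) = false
  /\ exec finish loop_start rN == contrib n 0 0 0.
Proof.
  intros Hv. rewrite loop_start_eq. pose proof relocate_spec as Hm.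
  set (m := exec relocate _) in *. clearbody m.
  assert (Hheap := setup_heap m). revert Hheap. apply setup_spec; [exact Hm|].
  intros m' _ E2 _ E4 _ _ _ _ _ _ _ _ E1 _ _ _ _ _ Hheap.
  assert (Hg : exec guard m' = upd (upd m' rItem (Qnat 0)) rStrD (Qnat 0)).
  { unfold guard. cbn [exec]. now rewrite E2, E4, Qnat_leb, Hv. }
  rewrite Hg. unfold finish. compute_exec. rewrite E1, E2, Qnat_sub by lia.
  split; [apply Qnat_leb|].
  rewrite contrib_zero; [|intros k Hk; pose proof (wt_le_vmax k Hk); lia|lia].
  rewrite addr_Qnat, Nat.sub_0_r. pose proof base_ge. unfold upd. heap_addresses.
  rewrite Hheap by lia. rewrite (l_free _ Hm) by lia. reflexivity.
Qed.

(** * Total correctness and running time *)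

Definition iterations : nat := if Nat.eqb vmax 0 then 0 else (n + 1) * strD.

Lemma prog_correct : exists m,
  reaches prog (size prologue + (iterations * (size body + 2) + 2) + size finish)
    0 (init_mem items lbin i) (length prog) m
  /\ m rN == contrib n 0 0 0.
Proof.
  assert (Hp : code_at prog 0 prog) by (intros j ins Hj; exact Hj).
  unfold prog at 2 in Hp. apply code_at_app in Hp. destruct Hp as [H1 Hp].
  apply code_at_app in Hp. destruct Hp as [H2 H3]. rewrite length_compile in H2, H3.
  assert (Hw : length (while_le (size prologue) rOne rItem body) = (3 + size body)%nat).
  { unfold while_le. cbn [length]. rewrite length_app, length_compile. cbn [length]. lia. }
  assert (Hlen : length prog = (size prologue + 3 + size body + size finish)%nat).
  { unfold prog. rewrite !length_app, !length_compile, Hw. lia. }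
  rewrite Hw in H3. rewrite Nat.add_0_l in H2, H3.
  replace (size prologue + (3 + size body))%nat
    with (size prologue + 3 + size body)%nat in H3 by lia.
  assert (Hloop : exists m, exec finish m rN == contrib n 0 0 0 /\
    reaches prog (iterations * (size body + 2) + 2)
      (size prologue) loop_start (size prologue + 3 + size body) m).
  { unfold iterations. destruct (Nat.eqb_spec vmax 0) as [Hv|Hv].
    - destruct (loop_start_degenerate Hv) as [Hstop Hfin].
      destruct (while_correct prog (size prologue) rOne rItem body 0
        (fun _ m => m = loop_start)) with (m := loop_start) as (m & -> & R);
        try reflexivity; try assumption.
      + intros; lia.
      + now intros m ->.
      + exists loop_start. split; [exact Hfin|exact R].
    - destruct (while_correct prog (size prologue) rOne rItem body ((n + 1) * strD) loop_inv)
        with (m := loop_start) as (m & Hm & R); try reflexivity; try assumption.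
      + exact body_spec.
      + intros m Hm. now apply loop_end.
      + apply loop_start_inv. lia.
      + exists m. split; [now apply loop_end|exact R]. }
  destruct Hloop as (m & Hfin & R). exists (exec finish m). split; [|exact Hfin].
  rewrite Hlen.
  pose proof (compile_correct prog prologue eq_refl 0 (init_mem items lbin i) H1) as R1.
  rewrite Nat.add_0_l in R1.
  pose proof (compile_correct prog finish eq_refl _ m H3) as R3.
  exact (reaches_trans _ _ _ _ _ _ _ _ _ (reaches_trans _ _ _ _ _ _ _ _ _ R1 R) R3).
Qed.

Lemma iterations_le :
  (iterations <= 24 * (lbin ^ 5 * wmax items lbin ^ 5 * n ^ 8))%nat.
Proof.
  unfold iterations. destruct (Nat.eqb_spec vmax 0) as [|Hv]; [lia|].
  destruct (len_bounds 0 ltac:(lia)) as [Hl Hb].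
  pose proof (wt_le_wmax items lbin 0 ltac:(lia) Hl Hb) as Hw.
  assert (Hw0 : (0 < wt 0)%nat) by (unfold vmax in Hv; nia).
  set (W := wmax items lbin) in *.
  assert (Hn : (n ^ 2 <= n ^ 8)%nat) by (apply Nat.pow_le_mono_r; lia).
  assert (Hlb : (lbin ^ 2 <= lbin ^ 5)%nat) by (apply Nat.pow_le_mono_r; lia).
  assert (HW : (W ^ 1 <= W ^ 5)%nat) by (apply Nat.pow_le_mono_r; lia).
  rewrite Nat.pow_1_r in HW.
  apply Nat.le_trans with (24 * (lbin ^ 2 * W * n ^ 2))%nat;
    [|apply Nat.mul_le_mono_l; apply Nat.mul_le_mono; [now apply Nat.mul_le_mono|exact Hn]].
  assert (Hs : (strL <= 2 * (lbin * W))%nat) by (unfold strL, vmax in *; nia).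
  (* The constant is 24 = 2 * 2 * 3 * 2, from n + 1 <= 2n twice, lbin + 2 <= 3 lbin, and vmax + 1 <=
     2 lbin W. *)
  apply Nat.le_trans with (2 * n * (2 * n * (3 * lbin * (2 * (lbin * W)))))%nat;
    [|cbn [Nat.pow]; lia].
  unfold strD, strS. repeat apply Nat.mul_le_mono; lia.
Qed.

End Correctness.

Theorem theorem4 :
  exists (P : program) (C : nat),
    forall (items : list (nat * nat)) (lbin i : nat),
      (forall k, (k < length items)%nat ->
         (0 < len items k)%nat /\ (len items k <= lbin)%nat) ->
      (forall k k', (k < k')%nat -> (k' < length items)%nat ->
         ratio items k' <= ratio items k) ->
      (i < length items)%nat ->
      exists m : memory,
        run P (C * (lbin ^ 5 * wmax items lbin ^ 5 * length items ^ 8 + 1))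
            0 (init_mem items lbin i) = Some m
        /\ m 0%nat == shapley items lbin i.
Proof.
  (* The first summand pays for the rounds of the loop, the second for the code outside it and the
     exit from the loop, covered by the + 1 in the bound. *)
  exists prog, (24 * (size body + 2) + (size prologue + 2 + size finish))%nat.
  intros items lbin i Hlen Hratio Hi.
  destruct (prog_correct items lbin i Hlen Hratio Hi) as (m & R & Hm).
  exists m. split; [|now rewrite Hm, shapley_contrib].
  eapply reaches_halt; [exact R|apply nth_error_None; lia|].
  pose proof (iterations_le items lbin i Hlen Hi) as Hit.
  set (X := (lbin ^ 5 * wmax items lbin ^ 5 * length items ^ 8)%nat) in *.
  pose proof (Nat.mul_le_mono_r _ _ (size body + 2) Hit). lia.
Qed.
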